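(* Let $K$ be a field, $\lambda\in K$, and let $(A,\mu,1,\alpha,\beta)$ be a unitary BiHom-associative algebra over $K$ with $\alpha,\beta$ bijective. Let $\psi,\omega:A\to A$ be linear maps such that any two of $\alpha,\beta,\psi,\omega$ commute, $\psi(ab)=\psi(a)\psi(b)$, $\omega(ab)=\omega(a)\omega(b)$ for all $a,b\in A$, and $\psi(1)=1=\omega(1)$. Let $r=r^1\otimes r^2\in A\otimes A$ satisfy $(f\otimes f)(r)=r$ for each $f\in\{\alpha,\beta,\psi,\omega\}$. Define $$\Delta_r(a)=\omega\alpha^{-1}(a)r^1\otimes\beta(r^2)-\alpha(r^1)\otimes r^2\,\psi\beta^{-1}(a)-\lambda(\omega(a)\otimes 1).$$ Then the $\lambda$-BiHom-derivation $\Delta_r$ is BiHom-coassociative, i.e. $(\Delta_r\otimes\psi)\circ\Delta_r=(\omega\otimes\Delta_r)\circ\Delta_r$, if and only if for all $a\in A$ $$\omega\alpha^{-1}(a)\triangleright(r_{13}r_{12}-r_{12}r_{23}+r_{23}r_{13}-\lambda r_{13})=(r_{13}r_{12}-r_{12}r_{23}+r_{23}r_{13}-\lambda r_{13})\triangleleft\psi\beta^{-1}(a).$$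
   Context: A BiHom-associative algebra $(A,\mu,\alpha,\beta)$ consists of a vector space $A$ and linear maps $\mu:A\otimes A\to A$ (written $ab$), $\alpha,\beta:A\to A$ with $\alpha\beta=\beta\alpha$, $\alpha(ab)=\alpha(a)\alpha(b)$, $\beta(ab)=\beta(a)\beta(b)$ and $\alpha(a)(bc)=(ab)\beta(c)$. It is unitary with unit $1$ if $\alpha(1)=1=\beta(1)$, $a1=\alpha(a)$, $1a=\beta(a)$ for all $a$. A linear map $\delta:A\to A\otimes A$, $\delta(a)=a_{[1]}\otimes a_{[2]}$, is a $\lambda$-BiHom-derivation if $(f\otimes f)\circ\delta=\delta\circ f$ for $f\in\{\alpha,\beta,\psi,\omega\}$ and $\delta(ab)=\omega(a)b_{[1]}\otimes\beta(b_{[2]})+\alpha(a_{[1]})\otimes a_{[2]}\psi(b)+\lambda\,\alpha\omega(a)\otimes\beta\psi(b)$. Actions of $A$ on $A\otimes A\otimes A$: $a\triangleright(x\otimes y\otimes z)=\omega(a)x\otimes\beta(y)\otimes\beta(z)$ and $(x\otimes y\otimes z)\triangleleft a=\alpha(x)\otimes\alpha(y)\otimes z\psi(a)$. With $r=r^1\otimes r^2=\bar r^1\otimes\bar r^2$ (sums suppressed), in $A\otimes A\otimes A$: $r_{12}r_{23}=\alpha(r^1)\otimes r^2\bar r^1\otimes\beta(\bar r^2)$, $\;r_{13}r_{12}=\omega(r^1)\bar r^1\otimes\beta(\bar r^2)\otimes\alpha\psi(r^2)$, $\;r_{23}r_{13}=\beta\omega(r^1)\otimes\alpha(\bar r^1)\otimes\bar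 r^2\psi(r^2)$, $\;r_{13}=\omega(r^1)\otimes1\otimes\psi(r^2)$. *)

(* Defs.v *)
From HB Require Import structures.
From mathcomp Require Import all_boot all_algebra.
From mathcomp Require Import boolp.
From mathcomp Require Import freeg.

Set Implicit Arguments.
Unset Strict Implicit.
Unset Printing Implicit Defensive.

Import GRing.Theory.
Local Open Scope ring_scope.
Local Open Scope quotient_scope.

Local Notation bilin F := (bilinear_for *:%R *:%R F).

(** Tensor product of two vector spaces:
    the free vector space on A * B modulo the bilinearity relations. *)

Inductive tensor_null (K : fieldType) (A B : lmodType K) :
    {freeg (A * B)%type / K} -> Prop :=
| tensor_nullDl a a' b :
    tensor_null (<< (a + a', b) >> - (<< (a, b) >> + << (a', b) >>))
| tensor_nullDr a b b' :
    tensor_null (<< (a, b + b') >> - (<< (a, b) >> + << (a, b') >>))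
| tensor_nullZl (k : K) a b :
    tensor_null (<< (k *: a, b) >> - k *: << (a, b) >>)
| tensor_nullZr (k : K) a b :
    tensor_null (<< (a, k *: b) >> - k *: << (a, b) >>)
| tensor_null0 : tensor_null 0
| tensor_nullP (k : K) x y :
    tensor_null x -> tensor_null y -> tensor_null (k *: x + y).

Section TensorType.
Variables (K : fieldType) (A B : lmodType K).
Local Notation free := {freeg (A * B)%type / K}.
Local Notation null := (@tensor_null K A B).
Implicit Types x y z : free.

Lemma tensor_nullD x y : null x -> null y -> null (x + y).
Proof. by move=> nx ny; rewrite -[x]scale1r; apply: tensor_nullP. Qed.

Lemma tensor_nullZ k x : null x -> null (k *: x).
Proof.
by move=> nx; rewrite -[_ *: _]addr0; apply/tensor_nullP/tensor_null0.
Qed.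

Lemma tensor_nullN x : null x -> null (- x).
Proof. by rewrite -scaleN1r; apply: tensor_nullZ. Qed.

Definition tensor_eq : rel free := fun x y => `[< null (x - y) >].

Lemma tensor_eq_refl : reflexive tensor_eq.
Proof. by move=> x; apply/asboolP; rewrite subrr; apply: tensor_null0. Qed.

Lemma tensor_eq_sym : symmetric tensor_eq.
Proof.
by move=> x y; apply/asboolP/asboolP => /tensor_nullN; rewrite opprB.
Qed.

Lemma tensor_eq_trans : transitive tensor_eq.
Proof.
move=> y x z /asboolP xy /asboolP yz; apply/asboolP.
by have := tensor_nullD xy yz; rewrite addrA subrK.
Qed.

Canonical tensor_equiv :=
  EquivRel tensor_eq tensor_eq_refl tensor_eq_sym tensor_eq_trans.
Canonical tensor_equiv_direct := defaultEncModRel tensor_eq.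

Definition tensor := {eq_quot tensor_eq}.
HB.instance Definition _ := Quotient.on tensor.
HB.instance Definition _ := Choice.on tensor.
HB.instance Definition _ : EqQuotient _ tensor_eq tensor :=
  EqQuotient.on tensor.

Implicit Types s t u : tensor.

Lemma tensorW (P : tensor -> Prop) :
  (forall x, P (\pi_tensor x)) -> forall t, P t.
Proof. by move=> Px t; rewrite -[t]reprK. Qed.

Lemma tensor_piP x y : null (x - y) -> \pi_tensor x = \pi_tensor y.
Proof. by move=> nxy; apply/(@eqquotP _ _ tensor)/asboolP. Qed.

Lemma tensor_reprP x : null (repr (\pi_tensor x) - x).
Proof. by apply/asboolP; apply/(@eqquotP _ _ tensor); rewrite reprK. Qed.

Definition tensor_add s t : tensor := \pi_tensor (repr s + repr t).
Definition tensor_opp s : tensor := \pi_tensor (- repr s).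
Definition tensor_scale (k : K) s : tensor := \pi_tensor (k *: repr s).

Lemma pi_tensor_add x y :
  \pi_tensor (x + y) = tensor_add (\pi_tensor x) (\pi_tensor y).
Proof.
apply/esym/tensor_piP; rewrite opprD addrACA.
by apply: tensor_nullD; apply: tensor_reprP.
Qed.

Lemma pi_tensor_opp x : \pi_tensor (- x) = tensor_opp (\pi_tensor x).
Proof.
apply/esym/tensor_piP; rewrite -opprD.
by apply/tensor_nullN/tensor_reprP.
Qed.

Lemma pi_tensor_scale k x : \pi_tensor (k *: x) = tensor_scale k (\pi_tensor x).
Proof.
apply/esym/tensor_piP; rewrite -scalerBr.
by apply/tensor_nullZ/tensor_reprP.
Qed.

Lemma tensor_addA : associative tensor_add.
Proof.
move=> s t u; elim/tensorW: s => x; elim/tensorW: t => y; elim/tensorW: u => z.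
by rewrite -!pi_tensor_add addrA.
Qed.

Lemma tensor_addC : commutative tensor_add.
Proof. by move=> s t; elim/tensorW: s => x; elim/tensorW: t => y; rewrite -!pi_tensor_add addrC. Qed.

Lemma tensor_add0 : left_id (\pi_tensor 0) tensor_add.
Proof. by move=> t; elim/tensorW: t => x; rewrite -pi_tensor_add add0r. Qed.

Lemma tensor_addN : left_inverse (\pi_tensor 0) tensor_opp tensor_add.
Proof. by move=> t; elim/tensorW: t => x; rewrite -pi_tensor_opp -pi_tensor_add addNr. Qed.

HB.instance Definition _ := GRing.isZmodule.Build tensor
  tensor_addA tensor_addC tensor_add0 tensor_addN.

Lemma tensor_scaleA k l t :
  tensor_scale k (tensor_scale l t) = tensor_scale (k * l) t.
Proof. by elim/tensorW: t => x; rewrite -!pi_tensor_scale scalerA. Qed.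

Lemma tensor_scale1 : left_id 1 tensor_scale.
Proof. by move=> t; elim/tensorW: t => x; rewrite -pi_tensor_scale scale1r. Qed.

Lemma tensor_scaleDr : right_distributive tensor_scale +%R.
Proof.
move=> k s t; elim/tensorW: s => x; elim/tensorW: t => y.
rewrite -[X in tensor_scale _ X]pi_tensor_add -!pi_tensor_scale scalerDr.
exact: pi_tensor_add.
Qed.

Lemma tensor_scaleDl t : {morph tensor_scale^~ t : k l / k + l}.
Proof.
elim/tensorW: t => x k l /=.
rewrite -!pi_tensor_scale scalerDl; exact: pi_tensor_add.
Qed.

HB.instance Definition _ := GRing.Zmodule_isLmodule.Build K tensor
  tensor_scaleA tensor_scale1 tensor_scaleDr tensor_scaleDl.

Definition pure_tensor (a : A) (b : B) : tensor := \pi_tensor (<< (a, b) >> : free).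

Lemma pi_tensor_linear : linear (\pi_tensor : free -> tensor).
Proof.
by move=> k x y; rewrite pi_tensor_add pi_tensor_scale.
Qed.

Lemma pure_tensor_bilin : bilin pure_tensor.
Proof.
have piD x y : \pi_tensor x + \pi_tensor y = \pi_tensor (x + y).
  exact/esym/pi_tensor_add.
have piZ k x : k *: \pi_tensor x = \pi_tensor (k *: x).
  exact/esym/pi_tensor_scale.
have Dl a a' b : pure_tensor (a + a') b = pure_tensor a b + pure_tensor a' b.
  by rewrite piD; apply/tensor_piP/tensor_nullDl.
have Dr a b b' : pure_tensor a (b + b') = pure_tensor a b + pure_tensor a b'.
  by rewrite piD; apply/tensor_piP/tensor_nullDr.
have Zl k a b : pure_tensor (k *: a) b = k *: pure_tensor a b.
  by rewrite piZ; apply/tensor_piP/tensor_nullZl.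
have Zr k a b : pure_tensor a (k *: b) = k *: pure_tensor a b.
  by rewrite piZ; apply/tensor_piP/tensor_nullZr.
split=> [b k a a'|a k b b'] /=.
- by rewrite Dl Zl.
- by rewrite Dr Zr.
Qed.

End TensorType.

Arguments pure_tensor {K A B} a b.
Arguments tensor_null {K A B} x.

Notation "a \ot b" := (pure_tensor a b)
  (at level 40, left associativity) : ring_scope.

(** [tsum F t] is the Sweedler-style sum of the [F t1 t2], for
    t = t1 (x) t2 (summation understood).  It is computed on a chosen
    representative of [t], hence meaningful only when [F] is bilinear: it is
    then the linear map through which [F] factors ([tsum_linear], [tsum_pure],
    [tensor_map_ext]). *)
Definition tsum (K : fieldType) (A B V : lmodType K) (F : A -> B -> V)
    (t : tensor A B) : V :=
  fglift (fun ab => F ab.1 ab.2) (repr t).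

Section UniversalProperty.
Variables (K : fieldType) (A B V : lmodType K).

Lemma fglift_linear (F : A * B -> V) :
  linear (fglift F : {freeg (A * B)%type / K} -> V).
Proof.
have fgB x y : fglift F (x - y) = fglift F x - fglift F y.
  exact: lift_is_additive.
have fg0 : fglift F 0 = 0 by have := fgB 0 0; rewrite !subrr.
have fgN x : fglift F (- x) = - fglift F x by rewrite -sub0r fgB fg0 sub0r.
have fgD x y : fglift F (x + y) = fglift F x + fglift F y.
  by rewrite -[y in LHS]opprK fgB fgN opprK.
move=> k x y; rewrite fgD; congr (_ + _).
rewrite -[in RHS](freeg_sumE x) /GRing.scale /= /fgscale.
rewrite (big_morph _ fgD fg0) (big_morph (fglift F) fgD fg0).
rewrite [RHS](big_morph _ (scalerDr k) (scaler0 _ k)).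
by apply: eq_bigr => p _; rewrite !liftU scalerA.
Qed.

Variable F : A -> B -> V.
Hypothesis linF : bilin F.

Let fg ab := F ab.1 ab.2.

Lemma fglift_null x : tensor_null x -> fglift fg x = 0.
Proof.
move: x; pose f : {freeg (A * B)%type / K} -> V := fglift fg.
have fP k x y : f (k *: x + y) = k *: f x + f y by exact: fglift_linear.
have fU p : f << p >> = fg p by rewrite /f liftU scale1r.
have fB x y : f (x - y) = f x - f y by exact: lift_is_additive.
have f0 : f 0 = 0 by have := fB 0 0; rewrite !subrr.
have fD x y : f (x + y) = f x + f y by rewrite -[x]scale1r fP !scale1r.
have fZ k x : f (k *: x) = k *: f x by rewrite -[k *: x]addr0 fP f0 addr0.
have lF b : linear (F^~ b) by exact: linF.1.
have rF a : linear (F a) by exact: linF.2.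
have F0b b : F 0 b = 0.
  by have := lF b (-1) 0 0; rewrite /= scaler0 addr0 scaleN1r addNr.
have Fa0 a : F a 0 = 0.
  by have := rF a (-1) 0 0; rewrite /= scaler0 addr0 scaleN1r addNr.
move=> x; rewrite -/(f x); elim=> {x}.
- move=> a a' b; rewrite fB fD !fU /fg /=.
  by rewrite -[a in F (a + _)]scale1r [F _ _]lF scale1r subrr.
- move=> a b b'; rewrite fB fD !fU /fg /=.
  by rewrite -[b in F _ (b + _)]scale1r [F _ _]rF scale1r subrr.
- move=> k a b; rewrite fB fZ !fU /fg /=.
  by rewrite -[k *: a]addr0 [F _ _]lF F0b addr0 subrr.
- move=> k a b; rewrite fB fZ !fU /fg /=.
  by rewrite -[k *: b]addr0 [F _ _]rF Fa0 addr0 subrr.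
- exact: f0.
- by move=> k x y _ fx0 _ fy0; rewrite fP fx0 fy0 scaler0 addr0.
Qed.

Lemma tsum_pi x : tsum F (\pi_(tensor A B) x) = fglift fg x.
Proof.
have /fglift_null := tensor_reprP x.
by rewrite lift_is_additive => /subr0_eq.
Qed.

Lemma tsum_linear : linear (tsum F).
Proof.
move=> k; move=> s t; elim/tensorW: s => x; elim/tensorW: t => y.
by rewrite -pi_tensor_linear !tsum_pi fglift_linear.
Qed.

Lemma tsum_pure a b : tsum F (a \ot b) = F a b.
Proof. by rewrite tsum_pi liftU scale1r. Qed.

End UniversalProperty.

Lemma tensor_map_ext (K : fieldType) (A B V : lmodType K)
    (f g : {linear tensor A B -> V}) :
  (forall a b, f (a \ot b) = g (a \ot b)) -> f =1 g.
Proof.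
move=> fg; move=> t; elim/tensorW: t => x.
pose piL := GRing.isLinear.Build _ _ _ _ _ (@pi_tensor_linear K A B).
pose p : {linear {freeg (A * B)%type / K} -> tensor A B} :=
  HB.pack (\pi_(tensor A B) : {freeg (A * B)%type / K} -> tensor A B) piL.
rewrite -[\pi x]/(p x) -(freeg_sumE x) !linear_sum; apply: eq_bigr => -[a b] _.
have -> : << coeff (a, b) x *g (a, b) >> =
          coeff (a, b) x *: << (a, b) >> :> {freeg (A * B)%type / K}.
  by apply/eqP/freeg_eqP => y; rewrite coeffZ !coeffU mul1r.
by rewrite !linearZ /=; congr (_ *: _); apply: fg.
Qed.

Lemma tsum_fun_linear (K : fieldType) (A B V : lmodType K) (k : K)
    (F G : A -> B -> V) (t : tensor A B) :
  tsum (fun a b => k *: F a b + G a b) t = k *: tsum F t + tsum G t.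
Proof.
rewrite /tsum -[repr t]freeg_repr !fglift_Freeg /prelift scaler_sumr -big_split.
by apply: eq_bigr => p _; rewrite scalerDr !scalerA mulrC.
Qed.

Lemma eq_tsum (K : fieldType) (A B V : lmodType K) (F G : A -> B -> V)
    (t : tensor A B) :
  (forall a b, F a b = G a b) -> tsum F t = tsum G t.
Proof.
move=> FG; rewrite /tsum -[repr t]freeg_repr !fglift_Freeg.
by apply: eq_bigr => p _; rewrite FG.
Qed.

Definition tensor_map (K : fieldType) (A A' B B' : lmodType K)
    (f : A -> A') (g : B -> B') : tensor A B -> tensor A' B' :=
  tsum (fun a b => f a \ot g b).

Lemma tensor_map_bilin (K : fieldType) (A A' B B' : lmodType K)
    (f : {linear A -> A'}) (g : {linear B -> B'}) :
  bilin (fun a b => f a \ot g b).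
Proof.
split=> [b k a a'|a k b b'] /=; rewrite linearP.
- exact: (pure_tensor_bilin A' B').1.
- exact: (pure_tensor_bilin A' B').2.
Qed.

Lemma tensor_map_pure (K : fieldType) (A A' B B' : lmodType K)
    (f : {linear A -> A'}) (g : {linear B -> B'}) a b :
  tensor_map f g (a \ot b) = f a \ot g b.
Proof. exact/tsum_pure/tensor_map_bilin. Qed.

(** The identification of A (x) (B (x) C) with (A (x) B) (x) C. *)
Definition tensor_assoc (K : fieldType) (A B C : lmodType K) :
    tensor A (tensor B C) -> tensor (tensor A B) C :=
  tsum (fun a => tsum (fun b c => a \ot b \ot c)).

Lemma tensor_assoc_pure (K : fieldType) (A B C : lmodType K)
    (a : A) (b : B) (c : C) :
  tensor_assoc (a \ot (b \ot c)) = a \ot b \ot c.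
Proof.
have bil x : bilin (fun b c => x \ot b \ot c : tensor (tensor A B) C).
  split=> [z k y y'|y k z z'] /=.
  - by rewrite (pure_tensor_bilin A B).2 (pure_tensor_bilin _ C).1.
  - exact: (pure_tensor_bilin _ C).2.
rewrite /tensor_assoc tsum_pure ?tsum_pure //.
split=> [t k x x'|x] /=; last exact/tsum_linear/bil.
rewrite -tsum_fun_linear; apply: eq_tsum => y z.
by rewrite (pure_tensor_bilin A B).1 (pure_tensor_bilin _ C).1.
Qed.

Section InverseMap.
Variables (U V : choiceType) (f : U -> V) (bij_f : bijective f).

Lemma bij_preimage v : exists u, f u == v.
Proof. by case: bij_f => g _ gK; exists (g v); rewrite gK. Qed.

Definition bij_inverse (v : V) : U := xchoose (bij_preimage v).

Lemma bij_inverseK : cancel bij_inverse f.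
Proof. by move=> v; apply/eqP/(xchooseP (bij_preimage v)). Qed.

Lemma bij_inverseKV : cancel f bij_inverse.
Proof. by move=> u; apply: (bij_inj bij_f); rewrite bij_inverseK. Qed.

End InverseMap.

Section BiHom.
Variables (K : fieldType) (A : lmodType K).
Variable (mu : {linear tensor A A -> A}).
Implicit Types (alpha beta psi omega : {linear A -> A}).

Local Notation "a ** b" := (mu (a \ot b))
  (at level 40, left associativity).

Record BiHom_associative alpha beta : Prop := {
  bha_comm : alpha \o beta =1 beta \o alpha;
  bha_alphaM : forall a b, alpha (a ** b) = alpha a ** alpha b;
  bha_betaM : forall a b, beta (a ** b) = beta a ** beta b;
  bha_assoc : forall a b c, alpha a ** (b ** c) = (a ** b) ** beta c
}.

Record BiHom_unit (one : A) alpha beta : Prop := {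
  bhu_alpha1 : alpha one = one;
  bhu_beta1 : beta one = one;
  bhu_mul1r : forall a, a ** one = alpha a;
  bhu_mul1l : forall a, one ** a = beta a
}.

Record BiHom_derivation (lambda : K) alpha beta psi omega
    (delta : A -> tensor A A) : Prop := {
  bhd_linear : linear delta;
  bhd_alpha : tensor_map alpha alpha \o delta =1 delta \o alpha;
  bhd_beta : tensor_map beta beta \o delta =1 delta \o beta;
  bhd_psi : tensor_map psi psi \o delta =1 delta \o psi;
  bhd_omega : tensor_map omega omega \o delta =1 delta \o omega;
  bhd_mul : forall a b, delta (a ** b) =
    tsum (fun b1 b2 => (omega a ** b1) \ot beta b2) (delta b)
    + tsum (fun a1 a2 => alpha a1 \ot (a2 ** psi b)) (delta a)
    + lambda *: (alpha (omega a) \ot beta (psi b))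
}.

Definition BiHom_coassociative psi omega (delta : A -> tensor A A) : Prop :=
  tensor_map delta psi \o delta
    =1 @tensor_assoc K A A A \o tensor_map omega delta \o delta.

(** Threefold tensors are left-nested: A (x) A (x) A is
    [tensor (tensor A A) A]. *)

Definition left_act beta omega (a : A) :
    tensor (tensor A A) A -> tensor (tensor A A) A :=
  tsum (fun xy z =>
    tsum (fun x y => (omega a ** x) \ot beta y \ot beta z) xy).

Definition right_act alpha psi (t : tensor (tensor A A) A) (a : A) :
    tensor (tensor A A) A :=
  tsum (fun xy z =>
    tsum (fun x y => alpha x \ot alpha y \ot (z ** psi a)) xy) t.

Definition r12r23 alpha beta (r : tensor A A) : tensor (tensor A A) A :=
  tsum (fun r1 r2 => tsum (fun s1 s2 =>
    alpha r1 \ot (r2 ** s1) \ot beta s2) r) r.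

Definition r13r12 alpha beta psi omega (r : tensor A A) :
    tensor (tensor A A) A :=
  tsum (fun r1 r2 => tsum (fun s1 s2 =>
    (omega r1 ** s1) \ot beta s2 \ot alpha (psi r2)) r) r.

Definition r23r13 alpha beta psi omega (r : tensor A A) :
    tensor (tensor A A) A :=
  tsum (fun r1 r2 => tsum (fun s1 s2 =>
    beta (omega r1) \ot alpha s1 \ot (s2 ** psi r2)) r) r.

Definition r13 (one : A) psi omega (r : tensor A A) :
    tensor (tensor A A) A :=
  tsum (fun r1 r2 => omega r1 \ot one \ot psi r2) r.

(** [alphaV] and [betaV] stand for the inverses of alpha and beta. *)
Definition Delta (lambda : K) (one : A) alpha beta psi omega
    (alphaV betaV : A -> A) (r : tensor A A) (a : A) : tensor A A :=
  tsum (fun r1 r2 => (omega (alphaV a) ** r1) \ot beta r2) r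
  - tsum (fun r1 r2 => alpha r1 \ot (r2 ** psi (betaV a))) r
  - lambda *: (omega a \ot one).

End BiHom.

(* Main.v *)
(* The coassociator of Delta_r equals the defect of the condition on
   E = r13r12 - r12r23 + r23r13 - lambda r13, on the nose:
     (Delta_r (x) psi) Delta_r(a) - (omega (x) Delta_r) Delta_r(a)
       = omega alpha^-1(a) |> E - E <| psi beta^-1(a).
   Expanding the left side gives nine terms on each side of the minus sign,
   each a multilinear expression in at most two copies of r.  Replacing a copy
   of r by (f (x) f)(r) for suitable f in {alpha, beta, psi, omega} and using
   BiHom-associativity, eight of them are the eight terms of the right side;
   the others cancel in pairs. *)

Require Import Defs.
From HB Require Import structures.
From mathcomp Require Import all_boot all_algebra.
From mathcomp Require Import freeg.
Import GRing.Theory.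
Local Open Scope ring_scope.
Set Implicit Arguments.
Unset Strict Implicit.
Unset Printing Implicit Defensive.

Local Notation bilin F := (bilinear_for *:%R *:%R F).

(** * Linearity, exchange and change of variables for Sweedler sums *)

Section TensorTheory.
Variable K : fieldType.

HB.instance Definition _ (A B : lmodType K) :=
  bilinear_isBilinear.Build K A B (tensor A B) *:%R *:%R (@pure_tensor K A B)
    (pure_tensor_bilin A B).

Lemma pure_tensorPl (A B : lmodType K) (k : K) (a a' : A) (b : B) :
  (k *: a + a') \ot b = k *: (a \ot b) + a' \ot b.
Proof. exact: linearPl. Qed.

Lemma pure_tensorPr (A B : lmodType K) (k : K) (a : A) (b b' : B) :
  a \ot (k *: b + b') = k *: (a \ot b) + a \ot b'.
Proof. exact: linearPr. Qed.

HB.instance Definition _ (A B : lmodType K) (a : A) :=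
  GRing.isLinear.Build K B (tensor A B) *:%R (pure_tensor a)
    (fun k => @pure_tensorPr A B k a).

(** Both sides are finite sums over the same representative [repr t], so the identity holds for any
    function [F]. The exchange of two Sweedler sums below rests on the same remark. *)
Lemma tsum_lin (A B V W : lmodType K) (h : {linear V -> W}) (F : A -> B -> V)
    (t : tensor A B) : h (tsum F t) = tsum (fun a b => h (F a b)) t.
Proof.
rewrite /tsum -[repr t]freeg_repr !fglift_Freeg /prelift linear_sum.
by apply: eq_bigr => p _; rewrite linearZ.
Qed.

Lemma exchange_tsum (A B C D V : lmodType K) (F : A -> B -> C -> D -> V)
    (s : tensor A B) (t : tensor C D) :
  tsum (fun a b => tsum (F a b) t) s =
  tsum (fun c d => tsum (fun a b => F a b c d) s) t.
Proof.
rewrite /tsum -[repr t]freeg_repr -[repr s]freeg_repr !fglift_Freeg /prelift.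
under eq_bigr do rewrite fglift_Freeg scaler_sumr.
under [RHS]eq_bigr do rewrite fglift_Freeg scaler_sumr.
rewrite exchange_big; apply: eq_bigr => p _; apply: eq_bigr => q _.
by rewrite !scalerA mulrC.
Qed.

Lemma tsumB (A B V : lmodType K) (F G : A -> B -> V) (t : tensor A B) :
  tsum (fun a b => F a b - G a b) t = tsum F t - tsum G t.
Proof.
rewrite addrC -scaleN1r -tsum_fun_linear; apply: eq_tsum => a b.
by rewrite scaleN1r addrC.
Qed.

Lemma tsumZ (A B V : lmodType K) k (F : A -> B -> V) (t : tensor A B) :
  tsum (fun a b => k *: F a b) t = k *: tsum F t.
Proof. by rewrite -(tsum_lin (@GRing.scale K V k)). Qed.

Lemma tsum_purel (A B C D : lmodType K) (F : A -> B -> C) (t : tensor A B)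
    (d : D) : tsum F t \ot d = tsum (fun a b => F a b \ot d) t.
Proof. exact: (tsum_lin (applyr (@pure_tensor K C D) d)). Qed.

(** The chosen representatives of [t] and of [tensor_map f g t] are unrelated. Bilinearity of [F]
    makes [tsum F] a linear map, which can then be evaluated on the pure tensors that make up
    [tensor_map f g t]. *)
Lemma tsum_map (A A' B B' V : lmodType K) (f : {linear A -> A'})
    (g : {linear B -> B'}) (F : A' -> B' -> V) (t : tensor A B) :
  bilin F -> tsum F (tensor_map f g t) = tsum (fun a b => F (f a) (g b)) t.
Proof.
move=> linF; have linV := tsum_linear linF.
pose h : {linear tensor A' B' -> V} :=
  HB.pack (tsum F) (GRing.isLinear.Build _ _ _ _ _ linV).
rewrite /tensor_map -[LHS]/(h _) tsum_lin.
by apply: eq_tsum => a b; rewrite /h /= tsum_pure.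
Qed.

Lemma bilin_tsum_fun (A B C D V : lmodType K) (F : A -> B -> C -> D -> V)
    (t : tensor C D) :
  (forall c d, bilin (fun a b => F a b c d)) ->
  bilin (fun a b => tsum (F a b) t).
Proof.
move=> linF; split=> [b k a a'|a k b b'] /=; rewrite -tsum_fun_linear;
  apply: eq_tsum => c d.
- exact: (linF c d).1.
- exact: (linF c d).2.
Qed.

Lemma bilin_tsum (A B C V : lmodType K) (F : A -> B -> C -> V) :
  (forall c, bilin (fun a b => F a b c)) -> (forall a b, linear (F a b)) ->
  bilin (fun t c => tsum (fun a b => F a b c) t).
Proof.
move=> linF linC; split=> [c|t] k x y /=; first exact: tsum_linear.
by rewrite -tsum_fun_linear; apply: eq_tsum => a b; rewrite linC.
Qed.

HB.instance Definition _ (A A' B B' : lmodType K) (f : {linear A -> A'})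
    (g : {linear B -> B'}) :=
  GRing.isLinear.Build K (tensor A B) (tensor A' B') *:%R (tensor_map f g)
    (tsum_linear (tensor_map_bilin f g)).

Lemma tensor_assoc_linear (A B C : lmodType K) :
  linear (@tensor_assoc K A B C).
Proof.
have bil x : bilin (fun b c => x \ot b \ot c : tensor (tensor A B) C).
  by split=> [z k y y'|y k z z'] /=; rewrite ?linearPr ?linearPl.
apply: tsum_linear; split=> [t k x x'|x] /=; last exact/tsum_linear/bil.
by rewrite -tsum_fun_linear; apply: eq_tsum => y z; rewrite !linearPl.
Qed.

HB.instance Definition _ (A B C : lmodType K) :=
  GRing.isLinear.Build K (tensor A (tensor B C)) (tensor (tensor A B) C) *:%R
    (@tensor_assoc K A B C) (@tensor_assoc_linear A B C).

End TensorTheory.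
(** Bookkeeping for the final comparison: the [t]'s are the nine terms of the first composite, the
    [u]'s belong to the second. A [t] that reappears in the second composite marks a pair of terms
    already identified. *)
Lemma coassociator_terms_cancel (V : zmodType)
    (t1 t2 t3 t4 t5 t6 t7 t8 t9 u1 u2 u5 : V) :
  t1 - t2 - t3 - (t4 - t5 - t6) - (t7 - t8 - t9) -
  (u1 - u2 - t7 - (t2 - u5 - t8) + t9) =
  t1 - u1 + u2 - t3 - (t4 - t5 + u5 - t6).
Proof.
rewrite !(opprB, opprD, opprK, addrA).
(* One pair is already adjacent; the permutation lists the eight surviving terms first and puts the
   other three cancelling pairs at the end. *)
rewrite subrK [LHS](ACl (1*10*9*3*4*5*6*13*2*12*8*11*7*14)) /=.
by rewrite subrK !addrK.
Qed.

(** * Normal forms in the BiHom-algebra and twisting of the copies of [r] *)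

Section BiHomTheory.
Variables (K : fieldType) (lambda : K) (A : lmodType K).
Variables (mu : {linear tensor A A -> A}) (one : A).
Variables alpha beta psi omega : {linear A -> A}.
Hypothesis A_assoc : BiHom_associative mu alpha beta.
Hypothesis A_unit : BiHom_unit mu one alpha beta.
Variables alphaV betaV : {linear A -> A}.
Hypotheses (alphaK : cancel alpha alphaV) (alphaVK : cancel alphaV alpha).
Hypotheses (betaK : cancel beta betaV) (betaVK : cancel betaV beta).
Hypothesis psi_alpha : psi \o alpha =1 alpha \o psi.
Hypothesis psi_beta : psi \o beta =1 beta \o psi.
Hypothesis omega_alpha : omega \o alpha =1 alpha \o omega.
Hypothesis omega_beta : omega \o beta =1 beta \o omega.
Hypothesis psi_omega : psi \o omega =1 omega \o psi.
Hypothesis psiM : forall a b, psi (mu (a \ot b)) = mu (psi a \ot psi b).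
Hypothesis omegaM : forall a b, omega (mu (a \ot b)) = mu (omega a \ot omega b).
Hypotheses (psi1 : psi one = one) (omega1 : omega one = one).
Variable r : tensor A A.
Hypothesis r_alpha : tensor_map alpha alpha r = r.
Hypothesis r_beta : tensor_map beta beta r = r.
Hypothesis r_psi : tensor_map psi psi r = r.
Hypothesis r_omega : tensor_map omega omega r = r.

Local Notation "a ** b" := (mu (a \ot b)) (at level 40, left associativity).
Local Notation Delta_r := (Delta mu lambda one alpha beta psi omega alphaV betaV r).

Let comm_inverse (f g gV : {linear A -> A}) :
  cancel g gV -> cancel gV g -> f \o g =1 g \o f -> f \o gV =1 gV \o f.
Proof. by move=> gK gVK fg x; apply: (can_inj gK); rewrite -[LHS]fg /= !gVK. Qed.

Let comm_sym (f g : {linear A -> A}) : f \o g =1 g \o f -> g \o f =1 f \o g.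
Proof. by move=> fg x; rewrite fg. Qed.

(* Rewriting with these commutations orders every composite of structure maps
   as [beta, betaV, alpha, alphaV, omega, psi], outermost first. *)
Let alpha_beta : alpha \o beta =1 beta \o alpha := bha_comm A_assoc.
Let alpha_betaV : alpha \o betaV =1 betaV \o alpha :=
  comm_inverse betaK betaVK alpha_beta.
Let alphaV_beta : alphaV \o beta =1 beta \o alphaV :=
  comm_sym (comm_inverse alphaK alphaVK (comm_sym alpha_beta)).
Let alphaV_betaV : alphaV \o betaV =1 betaV \o alphaV :=
  comm_inverse betaK betaVK alphaV_beta.
Let omega_alphaV : omega \o alphaV =1 alphaV \o omega :=
  comm_inverse alphaK alphaVK omega_alpha.
Let omega_betaV : omega \o betaV =1 betaV \o omega :=
  comm_inverse betaK betaVK omega_beta.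
Let psi_alphaV : psi \o alphaV =1 alphaV \o psi :=
  comm_inverse alphaK alphaVK psi_alpha.
Let psi_betaV : psi \o betaV =1 betaV \o psi :=
  comm_inverse betaK betaVK psi_beta.

Let pw (f g : {linear A -> A}) : f \o g =1 g \o f -> forall x, f (g x) = g (f x).
Proof. by []. Qed.

Let commE := (pw alpha_beta, pw alpha_betaV, pw alphaV_beta, pw alphaV_betaV,
  pw omega_alpha, pw omega_alphaV, pw omega_beta, pw omega_betaV,
  pw psi_alpha, pw psi_alphaV, pw psi_beta, pw psi_betaV, pw psi_omega,
  alphaK, alphaVK, betaK, betaVK).

Let inverseM (f fV : {linear A -> A}) : cancel f fV -> cancel fV f ->
  (forall a b, f (a ** b) = f a ** f b) ->
  forall a b, fV (a ** b) = fV a ** fV b.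
Proof. by move=> fK fVK fM a b; apply: (can_inj fK); rewrite fM !fVK. Qed.

Let mulA := bha_assoc A_assoc.
Let alphaM := bha_alphaM A_assoc.
Let betaM := bha_betaM A_assoc.
Let morphM := (alphaM, betaM, inverseM alphaK alphaVK alphaM,
  inverseM betaK betaVK betaM, psiM, omegaM).

Let alpha1 := bhu_alpha1 A_unit.
Let beta1 := bhu_beta1 A_unit.
Let alphaV1 : alphaV one = one. Proof. by rewrite -[in LHS]alpha1 alphaK. Qed.
Let betaV1 : betaV one = one. Proof. by rewrite -[in LHS]beta1 betaK. Qed.
Let oneE := (alpha1, beta1, alphaV1, betaV1, psi1, omega1, bhu_mul1r A_unit,
  bhu_mul1l A_unit).
Let nfE := (oneE, morphM, commE).

(** BiHom-associativity solved for an arbitrary left factor, so that it rewrites to left-nested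
    products. Together with [nfE] it brings both sides of a multilinear identity to a common
    form. *)
Let mulAl a b c : a ** (b ** c) = (alphaV a ** b) ** beta c.
Proof. by rewrite -mulA alphaVK. Qed.

Local Ltac multilinear :=
  split=> [?|?] k ? ? /=; by rewrite !(linearP, pure_tensorPl, pure_tensorPr).

(** This is how invariance of [r] is used: [f] may be inserted in both legs of a Sweedler sum at
    once. The versions for two copies of [r] twist each copy independently. *)
Lemma tsum_invariant (V : lmodType K) (f : {linear A -> A}) (F : A -> A -> V) :
  tensor_map f f r = r -> bilin F ->
  tsum (fun a b => F (f a) (f b)) r = tsum F r.
Proof. by move=> {2}<- linF; rewrite tsum_map. Qed.

(* Both Sweedler sums range over the same tensor [r]. *)
Local Notation "'\tsum_' ( r1 , r2 , s1 , s2 ) e" :=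
  (tsum (fun r1 r2 => tsum (fun s1 s2 => e) r) r)
  (at level 41, r1 name, r2 name, s1 name, s2 name, e at level 41).

Lemma eq_tsum2 (V : lmodType K) (F G : A -> A -> A -> A -> V) :
  (forall a b c d, F a b c d = G a b c d) ->
  \tsum_(a, b, c, d) F a b c d = \tsum_(a, b, c, d) G a b c d.
Proof. by move=> FG; apply: eq_tsum => a b; apply: eq_tsum => c d. Qed.

Lemma tsum2_lin (V W : lmodType K) (h : {linear V -> W})
    (F : A -> A -> A -> A -> V) :
  h (\tsum_(a, b, c, d) F a b c d) = \tsum_(a, b, c, d) h (F a b c d).
Proof. by rewrite tsum_lin; apply: eq_tsum => a b; apply: tsum_lin. Qed.

Lemma tsum2_invariantl (V : lmodType K) (f : {linear A -> A})
    (F : A -> A -> A -> A -> V) :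
  tensor_map f f r = r -> (forall c d, bilin (fun a b => F a b c d)) ->
  \tsum_(a, b, c, d) F (f a) (f b) c d = \tsum_(a, b, c, d) F a b c d.
Proof.
move=> r_f linF; apply: (tsum_invariant (F := fun a b => tsum (F a b) r)) => //.
exact: bilin_tsum_fun.
Qed.

Lemma tsum2_invariantr (V : lmodType K) (f : {linear A -> A})
    (F : A -> A -> A -> A -> V) :
  tensor_map f f r = r -> (forall a b, bilin (F a b)) ->
  \tsum_(a, b, c, d) F a b (f c) (f d) = \tsum_(a, b, c, d) F a b c d.
Proof. by move=> r_f linF; apply: eq_tsum => a b; apply: tsum_invariant. Qed.

(** * [Delta_r] is a BiHom-derivation *)

Lemma Delta_linear : linear Delta_r.
Proof.
move=> k a a'; rewrite /Delta !linearP /= pure_tensorPl.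
under eq_tsum do rewrite !(linearP, pure_tensorPl).
under [X in _ - X - _]eq_tsum do rewrite !(linearP, pure_tensorPr).
rewrite !tsum_fun_linear scalerDr !scalerBr !scalerA [lambda * k]mulrC.
by rewrite !opprD [X in X + _ = _]addrACA [LHS]addrACA.
Qed.

(** Both the derivation law and the coassociator apply a Sweedler sum to a value of [Delta_r]. Since
    [tsum F] is linear, it distributes over the three pieces of that value. *)
Lemma tsum_Delta (V : lmodType K) (F : A -> A -> V) (a : A) : bilin F ->
  tsum F (Delta_r a) =
  tsum (fun r1 r2 => F (omega (alphaV a) ** r1) (beta r2)) r
  - tsum (fun r1 r2 => F (alpha r1) (r2 ** psi (betaV a))) r
  - lambda *: F (omega a) one.
Proof.
move=> linF; have linV := tsum_linear linF.
pose h : {linear tensor A A -> V} :=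
  HB.pack (tsum F) (GRing.isLinear.Build _ _ _ _ _ linV).
rewrite /Delta -[LHS]/(h _) !linearB linearZ !(tsum_lin h) /h /= tsum_pure //.
by congr (_ - _ - _); apply: eq_tsum => r1 r2; rewrite tsum_pure.
Qed.

(** Naturality: an algebra map that commutes with the structure maps and fixes [r] and the unit
    preserves every ingredient of [Delta_r]. It is applied to each of the four structure maps. *)
Lemma Delta_comm (f : {linear A -> A}) :
  (forall a b, f (a ** b) = f a ** f b) -> f one = one ->
  f \o omega =1 omega \o f -> f \o alphaV =1 alphaV \o f ->
  f \o psi =1 psi \o f -> f \o betaV =1 betaV \o f ->
  f \o alpha =1 alpha \o f -> f \o beta =1 beta \o f ->
  tensor_map f f r = r -> tensor_map f f \o Delta_r =1 Delta_r \o f.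
Proof.
move=> fM f1 /pw fomega /pw falphaV /pw fpsi /pw fbetaV /pw falpha /pw fbeta r_f a /=.
rewrite /tensor_map tsum_Delta; last by multilinear.
rewrite /Delta f1 fomega; congr (_ - _ - _).
- rewrite -[RHS](tsum_invariant r_f) => [|]; last by multilinear.
  by apply: eq_tsum => r1 r2; rewrite fM fomega falphaV fbeta.
- rewrite -[RHS](tsum_invariant r_f) => [|]; last by multilinear.
  by apply: eq_tsum => r1 r2; rewrite fM fpsi fbetaV falpha.
Qed.

Lemma Delta_derivation : BiHom_derivation mu lambda alpha beta psi omega Delta_r.
Proof.
split; first exact: Delta_linear.
- by apply: Delta_comm => // x /=; rewrite !nfE.
- by apply: Delta_comm => // x /=; rewrite !nfE.
- by apply: Delta_comm => // x /=; rewrite !nfE.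
- by apply: Delta_comm => // x /=; rewrite !nfE.
move=> a b; rewrite !tsum_Delta; try by multilinear.
rewrite /Delta.
(* Twisting [r] by [beta] supplies the [beta] that BiHom-associativity needs to rebracket the first
   leg; the next identity is its mirror image, with [alpha] and the second leg. *)
have -> : tsum (fun r1 r2 => (omega (alphaV (a ** b)) ** r1) \ot beta r2) r =
    tsum (fun r1 r2 => (omega a ** (omega (alphaV b) ** r1)) \ot
      beta (beta r2)) r.
  rewrite -(tsum_invariant r_beta) => [|]; last by multilinear.
  by apply: eq_tsum => r1 r2; rewrite !nfE -mulA alphaVK.
have -> : tsum (fun r1 r2 => alpha r1 \ot (r2 ** psi (betaV (a ** b)))) r =
    tsum (fun r1 r2 => alpha (alpha r1) \ot (r2 ** psi (betaV a) ** psi b)) r.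
  rewrite -(tsum_invariant r_alpha) => [|]; last by multilinear.
  by apply: eq_tsum => r1 r2; rewrite !nfE mulA betaVK.
(* The cross terms produced by [Delta_r b] and [Delta_r a] agree and have opposite signs. *)
have -> : tsum (fun r1 r2 => (omega a ** alpha r1) \ot
      beta (r2 ** psi (betaV b))) r =
    tsum (fun r1 r2 => alpha (omega (alphaV a) ** r1) \ot
      (beta r2 ** psi b)) r.
  by apply: eq_tsum => r1 r2; rewrite !nfE.
(* The unit law turns [one ** psi b] into [beta (psi b)], so the unit piece of [Delta_r a] cancels
   the last term of the derivation law. *)
rewrite omegaM beta1 (bhu_mul1l A_unit) -[RHS]addrA subrK [in RHS]addrAC.
by rewrite [in RHS]addrA subrK.
Qed.

HB.instance Definition _ := GRing.isLinear.Build K A (tensor A A) *:%R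
  Delta_r Delta_linear.

(** * [Delta_r] and the two actions on pure tensors *)

Lemma Delta_purel (u v : A) : Delta_r u \ot v =
  tsum (fun s1 s2 => (omega (alphaV u) ** s1) \ot beta s2 \ot v) r
  - tsum (fun s1 s2 => alpha s1 \ot (s2 ** psi (betaV u)) \ot v) r
  - lambda *: (omega u \ot one \ot v).
Proof. by rewrite /Delta !linearBl linearZl_LR /= !tsum_purel. Qed.

Lemma Delta_purer (u v : A) : tensor_assoc (u \ot Delta_r v) =
  tsum (fun s1 s2 => u \ot (omega (alphaV v) ** s1) \ot beta s2) r
  - tsum (fun s1 s2 => u \ot alpha s1 \ot (s2 ** psi (betaV v))) r
  - lambda *: (u \ot omega v \ot one).
Proof.
pose h : {linear tensor A A -> tensor (tensor A A) A} :=
  (@tensor_assoc K A A A) \o (pure_tensor u).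
rewrite /Delta -[LHS]/(h _) !linearB linearZ !(tsum_lin h) /= tensor_assoc_pure.
by congr (_ - _ - _); apply: eq_tsum => s1 s2; rewrite tensor_assoc_pure.
Qed.

Lemma left_act_bilin (u : A) : bilin (fun xy z => tsum (fun x y =>
    (omega u ** x) \ot beta y \ot beta z : tensor (tensor A A) A) xy).
Proof.
by apply: bilin_tsum => [z|x y]; [multilinear | move=> k z z'; rewrite !linearP].
Qed.

Lemma right_act_bilin (u : A) : bilin (fun xy z => tsum (fun x y =>
    alpha x \ot alpha y \ot (z ** psi u) : tensor (tensor A A) A) xy).
Proof.
apply: bilin_tsum => [z|x y]; first by multilinear.
by move=> k z z'; rewrite pure_tensorPl !linearP.
Qed.

HB.instance Definition _ (u : A) :=
  GRing.isLinear.Build K (tensor (tensor A A) A) (tensor (tensor A A) A) *:%R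
    (left_act mu beta omega u) (tsum_linear (left_act_bilin u)).

(** The tensor is made the last argument so that the right action of a fixed [u] can carry a linear
    structure. *)
Definition right_act_by u t := right_act mu alpha psi t u.

HB.instance Definition _ (u : A) :=
  GRing.isLinear.Build K (tensor (tensor A A) A) (tensor (tensor A A) A) *:%R
    (right_act_by u) (tsum_linear (right_act_bilin u)).

Lemma left_act_pure u a b c : left_act mu beta omega u (a \ot b \ot c) =
  (omega u ** a) \ot beta b \ot beta c.
Proof.
rewrite /left_act tsum_pure; last exact: left_act_bilin.
by rewrite tsum_pure //; multilinear.
Qed.

Lemma right_act_pure u a b c : right_act mu alpha psi (a \ot b \ot c) u =
  alpha a \ot alpha b \ot (c ** psi u).
Proof.
rewrite /right_act tsum_pure; last exact: right_act_bilin.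
by rewrite tsum_pure //; multilinear.
Qed.

(** * The eight terms of the defect, written as they occur in the coassociator *)

Local Ltac substl r_f := rewrite -(tsum2_invariantl r_f) => [|? ?]; [|by multilinear].
Local Ltac substr r_f := rewrite -(tsum2_invariantr r_f) => [|? ?]; [|by multilinear].

(** The twists are read off the legs: [beta] on the inner copy equalises the second leg and [alpha]
    on the outer copy the third. The first leg is then an instance of BiHom-associativity. The
    following lemmas choose their twists in the same way, and [apply/esym] selects the side to be
    twisted. *)
Lemma left_act_r13r12 (a : A) :
  left_act mu beta omega (omega (alphaV a)) (r13r12 mu alpha beta psi omega r) =
  \tsum_(r1, r2, s1, s2)
    (omega (alphaV (omega (alphaV a) ** r1)) ** s1) \ot beta s2 \ot psi (beta r2).
Proof.
rewrite [LHS](tsum2_lin (left_act mu beta omega (omega (alphaV a)))).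
under [LHS]eq_tsum2 do rewrite /= left_act_pure.
apply/esym; substl r_alpha; substr r_beta.
by apply: eq_tsum2 => r1 r2 s1 s2; rewrite !(nfE, mulAl).
Qed.

Lemma left_act_r12r23 (a : A) :
  left_act mu beta omega (omega (alphaV a)) (r12r23 mu alpha beta r) =
  \tsum_(r1, r2, s1, s2)
    omega (omega (alphaV a) ** r1) \ot (omega (alphaV (beta r2)) ** s1) \ot
      beta s2.
Proof.
rewrite [LHS](tsum2_lin (left_act mu beta omega (omega (alphaV a)))).
under [LHS]eq_tsum2 do rewrite /= left_act_pure.
substl r_omega.
apply/esym; substl r_alpha; substr r_beta.
by apply: eq_tsum2 => r1 r2 s1 s2; rewrite !(nfE, mulAl).
Qed.

Lemma left_act_r23r13 (a : A) :
  left_act mu beta omega (omega (alphaV a)) (r23r13 mu alpha beta psi omega r) =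
  \tsum_(r1, r2, s1, s2)
    omega (omega (alphaV a) ** r1) \ot alpha s1 \ot (s2 ** psi (betaV (beta r2))).
Proof.
rewrite [LHS](tsum2_lin (left_act mu beta omega (omega (alphaV a)))).
under [LHS]eq_tsum2 do rewrite /= left_act_pure.
apply/esym; substl r_beta; substr r_beta.
by apply: eq_tsum2 => r1 r2 s1 s2; rewrite !(nfE, mulAl).
Qed.

Lemma left_act_r13 (a : A) :
  left_act mu beta omega (omega (alphaV a)) (r13 one psi omega r) =
  tsum (fun r1 r2 => omega (omega (alphaV a) ** r1) \ot one \ot psi (beta r2)) r.
Proof.
rewrite [LHS](tsum_lin (left_act mu beta omega (omega (alphaV a)))).
by apply: eq_tsum => r1 r2; rewrite /= left_act_pure !nfE.
Qed.

Lemma right_act_r13r12 (a : A) :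
  right_act mu alpha psi (r13r12 mu alpha beta psi omega r) (psi (betaV a)) =
  \tsum_(r1, r2, s1, s2)
    (omega (alphaV (alpha r1)) ** s1) \ot beta s2 \ot psi (r2 ** psi (betaV a)).
Proof.
rewrite [LHS](tsum2_lin (right_act_by (psi (betaV a)))).
under [LHS]eq_tsum2 do rewrite /= /right_act_by right_act_pure.
apply/esym; substl r_alpha; substr r_alpha.
by apply: eq_tsum2 => r1 r2 s1 s2; rewrite !(nfE, mulAl).
Qed.

Lemma right_act_r12r23 (a : A) :
  right_act mu alpha psi (r12r23 mu alpha beta r) (psi (betaV a)) =
  \tsum_(r1, r2, s1, s2)
    alpha s1 \ot (s2 ** psi (betaV (alpha r1))) \ot psi (r2 ** psi (betaV a)).
Proof.
rewrite [LHS](tsum2_lin (right_act_by (psi (betaV a)))).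
under [LHS]eq_tsum2 do rewrite /= /right_act_by right_act_pure.
(* The outer copy of [r] on one side is the inner copy on the other, so the two sums are exchanged
   before matching. *)
substr r_psi; apply/esym; rewrite exchange_tsum; substl r_alpha; substr r_beta.
by apply: eq_tsum2 => r1 r2 s1 s2; rewrite !(nfE, mulAl).
Qed.

Lemma right_act_r23r13 (a : A) :
  right_act mu alpha psi (r23r13 mu alpha beta psi omega r) (psi (betaV a)) =
  \tsum_(r1, r2, s1, s2)
    omega (alpha r1) \ot alpha s1 \ot (s2 ** psi (betaV (r2 ** psi (betaV a)))).
Proof.
rewrite [LHS](tsum2_lin (right_act_by (psi (betaV a)))).
under [LHS]eq_tsum2 do rewrite /= /right_act_by right_act_pure.
apply/esym; substl r_beta; substr r_alpha.
by apply: eq_tsum2 => r1 r2 s1 s2; rewrite !(nfE, mulAl).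
Qed.

Lemma right_act_r13 (a : A) :
  right_act mu alpha psi (r13 one psi omega r) (psi (betaV a)) =
  tsum (fun r1 r2 => omega (alpha r1) \ot one \ot psi (r2 ** psi (betaV a))) r.
Proof.
rewrite [LHS](tsum_lin (right_act_by (psi (betaV a)))).
by apply: eq_tsum => r1 r2; rewrite /= /right_act_by right_act_pure !nfE.
Qed.

(** In both sums an image of [a] sits in the middle leg between a leg of one copy of [r] and a leg
    of the other, with opposite bracketings. After exchanging the copies on one side and twisting,
    BiHom-associativity identifies the two. *)
Lemma coassociator_mixed_terms (a : A) :
  \tsum_(r1, r2, s1, s2)
    omega (alpha r1) \ot (omega (alphaV (r2 ** psi (betaV a))) ** s1) \ot beta s2 =
  \tsum_(r1, r2, s1, s2)
    alpha s1 \ot (s2 ** psi (betaV (omega (alphaV a) ** r1))) \ot psi (beta r2).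
Proof.
substl r_alpha; substr r_psi.
apply/esym; rewrite exchange_tsum; substl r_omega; substl r_alpha.
by apply: eq_tsum2 => r1 r2 s1 s2; rewrite !(nfE, mulAl).
Qed.

(** These are the terms linear in [lambda] that are absent from the defect. The first two identities
    match terms across the two composites after a twist by [omega]. The third compares the two
    non-unit parts of [Delta_r one]: by the unit laws they are [r] twisted by [beta] and by [alpha],
    hence equal. *)
Lemma coassociator_unit_terms (a : A) :
  [/\ tsum (fun r1 r2 => omega (omega (alphaV a) ** r1) \ot omega (beta r2) \ot one) r =
      tsum (fun s1 s2 => (omega (alphaV (omega a)) ** s1) \ot beta s2 \ot psi one) r,
      tsum (fun r1 r2 => omega (alpha r1) \ot omega (r2 ** psi (betaV a)) \ot one) r =
      tsum (fun s1 s2 => alpha s1 \ot (s2 ** psi (betaV (omega a))) \ot psi one) r &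
      tsum (fun s1 s2 => omega (omega a) \ot (omega (alphaV one) ** s1) \ot beta s2) r =
      tsum (fun s1 s2 => omega (omega a) \ot alpha s1 \ot (s2 ** psi (betaV one))) r].
Proof.
split.
- rewrite -[RHS](tsum_invariant r_omega) => [|]; last by multilinear.
  by apply: eq_tsum => s1 s2; rewrite !nfE.
- rewrite -[RHS](tsum_invariant r_omega) => [|]; last by multilinear.
  by apply: eq_tsum => s1 s2; rewrite !nfE.
- rewrite -[LHS](tsum_invariant r_alpha) => [|]; last by multilinear.
  rewrite -[RHS](tsum_invariant r_beta) => [|]; last by multilinear.
  by apply: eq_tsum => s1 s2; rewrite !nfE.
Qed.

(** * Nine-term expansions of the two composites *)

Lemma coassociator_left (a : A) :
  tensor_map Delta_r psi (Delta_r a) =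
  \tsum_(r1, r2, s1, s2)
    (omega (alphaV (omega (alphaV a) ** r1)) ** s1) \ot beta s2 \ot psi (beta r2)
  - \tsum_(r1, r2, s1, s2)
    alpha s1 \ot (s2 ** psi (betaV (omega (alphaV a) ** r1))) \ot psi (beta r2)
  - lambda *:
    tsum (fun r1 r2 => omega (omega (alphaV a) ** r1) \ot one \ot psi (beta r2)) r
  - (\tsum_(r1, r2, s1, s2)
      (omega (alphaV (alpha r1)) ** s1) \ot beta s2 \ot psi (r2 ** psi (betaV a))
    - \tsum_(r1, r2, s1, s2)
      alpha s1 \ot (s2 ** psi (betaV (alpha r1))) \ot psi (r2 ** psi (betaV a))
    - lambda *:
      tsum (fun r1 r2 => omega (alpha r1) \ot one \ot psi (r2 ** psi (betaV a))) r)
  - lambda *: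
    (tsum (fun s1 s2 => (omega (alphaV (omega a)) ** s1) \ot beta s2 \ot psi one) r
    - tsum (fun s1 s2 => alpha s1 \ot (s2 ** psi (betaV (omega a))) \ot psi one) r
    - lambda *: (omega (omega a) \ot one \ot psi one)).
Proof.
rewrite {1}/tensor_map tsum_Delta; last by multilinear.
under eq_tsum do rewrite Delta_purel.
under [X in _ - X - _]eq_tsum do rewrite Delta_purel.
by rewrite Delta_purel !tsumB !tsumZ.
Qed.

Lemma coassociator_right (a : A) :
  tensor_assoc (tensor_map omega Delta_r (Delta_r a)) =
  \tsum_(r1, r2, s1, s2)
    omega (omega (alphaV a) ** r1) \ot (omega (alphaV (beta r2)) ** s1) \ot beta s2
  - \tsum_(r1, r2, s1, s2)
    omega (omega (alphaV a) ** r1) \ot alpha s1 \ot (s2 ** psi (betaV (beta r2)))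
  - lambda *:
    tsum (fun r1 r2 => omega (omega (alphaV a) ** r1) \ot omega (beta r2) \ot one) r
  - (\tsum_(r1, r2, s1, s2)
      omega (alpha r1) \ot (omega (alphaV (r2 ** psi (betaV a))) ** s1) \ot beta s2
    - \tsum_(r1, r2, s1, s2)
      omega (alpha r1) \ot alpha s1 \ot (s2 ** psi (betaV (r2 ** psi (betaV a))))
    - lambda *:
      tsum (fun r1 r2 => omega (alpha r1) \ot omega (r2 ** psi (betaV a)) \ot one) r)
  - lambda *:
    (tsum (fun s1 s2 => omega (omega a) \ot (omega (alphaV one) ** s1) \ot beta s2) r
    - tsum (fun s1 s2 => omega (omega a) \ot alpha s1 \ot (s2 ** psi (betaV one))) r
    - lambda *: (omega (omega a) \ot omega one \ot one)).
Proof.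
rewrite {1}/tensor_map tsum_Delta; last by multilinear.
rewrite linearB linearB linearZ.
rewrite 2!(tsum_lin (@tensor_assoc K A A A)).
under eq_tsum do rewrite /= Delta_purer.
under [X in _ - X - _]eq_tsum do rewrite /= Delta_purer.
by rewrite /= Delta_purer !tsumB !tsumZ.
Qed.

(** * Comparison of the coassociator with the defect of [E] *)

Local Notation E := (r13r12 mu alpha beta psi omega r - r12r23 mu alpha beta r
  + r23r13 mu alpha beta psi omega r - lambda *: r13 one psi omega r).

Lemma left_act_E (u : A) : left_act mu beta omega u E =
  left_act mu beta omega u (r13r12 mu alpha beta psi omega r)
  - left_act mu beta omega u (r12r23 mu alpha beta r)
  + left_act mu beta omega u (r23r13 mu alpha beta psi omega r)
  - lambda *: left_act mu beta omega u (r13 one psi omega r).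
Proof. by rewrite linearB linearD linearB linearZ. Qed.

Lemma right_act_E (u : A) : right_act mu alpha psi E u =
  right_act mu alpha psi (r13r12 mu alpha beta psi omega r) u
  - right_act mu alpha psi (r12r23 mu alpha beta r) u
  + right_act mu alpha psi (r23r13 mu alpha beta psi omega r) u
  - lambda *: right_act mu alpha psi (r13 one psi omega r) u.
Proof.
by rewrite -[LHS]/(right_act_by u E) linearB linearD linearB linearZ.
Qed.

Lemma coassociator_Delta (a : A) :
  tensor_map Delta_r psi (Delta_r a)
  - tensor_assoc (tensor_map omega Delta_r (Delta_r a)) =
  left_act mu beta omega (omega (alphaV a)) E
  - right_act mu alpha psi E (psi (betaV a)).
Proof.
rewrite left_act_E right_act_E.
rewrite left_act_r13r12 left_act_r12r23 left_act_r23r13 left_act_r13.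
rewrite right_act_r13r12 right_act_r12r23 right_act_r23r13 right_act_r13.
rewrite coassociator_left coassociator_right coassociator_mixed_terms.
have [-> -> ->] := coassociator_unit_terms a.
(* The two parts coming from [Delta_r one] in the second composite cancel, leaving only its term
   quadratic in [lambda]. Since [omega] and [psi] fix the unit, this term equals the quadratic term
   of the first composite. *)
rewrite omega1 psi1 !scalerBr subrr sub0r opprK.
exact: coassociator_terms_cancel.
Qed.

Lemma coassociative_iff :
  BiHom_coassociative psi omega Delta_r <->
  forall a, left_act mu beta omega (omega (alphaV a)) E =
    right_act mu alpha psi E (psi (betaV a)).
Proof.
split=> [coassoc a|EE a]; apply: subr0_eq.
- by rewrite -coassociator_Delta [X in X - _]coassoc subrr.
- by rewrite [LHS]coassociator_Delta EE subrr.
Qed.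
End BiHomTheory.

Theorem theorem3p6 (K : fieldType) (lambda : K) (A : lmodType K)
    (mu : {linear tensor A A -> A}) (one : A)
    (alpha beta psi omega : {linear A -> A})
    (A_assoc : BiHom_associative mu alpha beta)
    (A_unit : BiHom_unit mu one alpha beta)
    (alpha_bij : bijective alpha) (beta_bij : bijective beta)
    (psi_alpha : psi \o alpha =1 alpha \o psi)
    (psi_beta : psi \o beta =1 beta \o psi)
    (omega_alpha : omega \o alpha =1 alpha \o omega)
    (omega_beta : omega \o beta =1 beta \o omega)
    (psi_omega : psi \o omega =1 omega \o psi)
    (psiM : forall a b : A, psi (mu (a \ot b)) = mu (psi a \ot psi b))
    (omegaM : forall a b : A, omega (mu (a \ot b)) = mu (omega a \ot omega b))
    (psi1 : psi one = one) (omega1 : omega one = one)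
    (r : tensor A A)
    (r_alpha : tensor_map alpha alpha r = r)
    (r_beta : tensor_map beta beta r = r)
    (r_psi : tensor_map psi psi r = r)
    (r_omega : tensor_map omega omega r = r) :
  let alphaV := bij_inverse alpha_bij in
  let betaV := bij_inverse beta_bij in
  let Delta_r := Delta mu lambda one alpha beta psi omega alphaV betaV r in
  let E := r13r12 mu alpha beta psi omega r - r12r23 mu alpha beta r
           + r23r13 mu alpha beta psi omega r - lambda *: r13 one psi omega r in
  BiHom_derivation mu lambda alpha beta psi omega Delta_r /\
  (BiHom_coassociative psi omega Delta_r <->
   forall a : A,
     left_act mu beta omega (omega (alphaV a)) E =
     right_act mu alpha psi E (psi (betaV a))).
Proof.
have alphaK := bij_inverseKV alpha_bij; have alphaVK := bij_inverseK alpha_bij.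
have betaK := bij_inverseKV beta_bij; have betaVK := bij_inverseK beta_bij.
(* The inverse of a linear bijection is linear. The packed maps have the inverses of the statement
   as underlying functions, so the results of the section apply by conversion. *)
pose aV : {linear A -> A} := HB.pack (bij_inverse alpha_bij)
  (GRing.isLinear.Build _ _ _ _ _ (can2_linear alphaK alphaVK)).
pose bV : {linear A -> A} := HB.pack (bij_inverse beta_bij)
  (GRing.isLinear.Build _ _ _ _ _ (can2_linear betaK betaVK)).
split.
- exact: (@Delta_derivation K lambda A mu one alpha beta psi omega A_assoc A_unit
    aV bV).
- exact: (@coassociative_iff K lambda A mu one alpha beta psi omega A_assoc A_unit
    aV bV).
Qed.
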